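(* Let $S=\langle a_1,\ldots,a_e\rangle$ be a numerical semigroup with minimal generators $a_1<\cdots<a_e$ and genus $g$. Then the following are equivalent: (1) $a_e=2g+1$. (2) The assignment $\varphi(n)=2g+1-n$ induces a well-defined bijection $\varphi:\{1,\ldots,2g\}\cap S\longrightarrow\{1,\ldots,2g\}\setminus S$.
   Context: A numerical semigroup is a submonoid $S$ of $(\mathbb{N},+)$ (with $0\in\mathbb{N}$) whose complement in $\mathbb{N}$ is finite. It has a unique finite minimal generating set. Writing $S=\langle a_1,\ldots,a_e\rangle$ with $a_1<\cdots<a_e$ means that $a_1,\ldots,a_e$ are exactly the minimal generators of $S$. The genus $g=g(S)$ is the number of positive integers not in $S$ (the gaps of $S$). *)

(* Defs.v *)
From mathcomp Require Import all_boot finmap.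
From mathcomp Require Import boolp classical_sets functions cardinality.

Set Implicit Arguments.
Unset Strict Implicit.
Unset Printing Implicit Defensive.

Local Open Scope classical_set_scope.

Definition submonoid (S : set nat) : Prop :=
  S 0 /\ forall x y, S x -> S y -> S (x + y).

Definition numerical_semigroup (S : set nat) : Prop :=
  submonoid S /\ finite_set (~` S).

Definition gaps (S : set nat) : set nat := [set n | 0 < n /\ ~ S n].

(* [fset_set] is only meaningful on finite sets (it is empty on the others);
   the gaps of a numerical semigroup are finite. *)
Definition genus (S : set nat) : nat := #|` fset_set (gaps S)|%fset.

Definition generated (A : set nat) : set nat := smallest submonoid A.

Definition minimal_generating_set (S A : set nat) : Prop :=
  generated A = S /\ forall B, B `<=` A -> generated B = S -> B = A.

(* S = <a_1, ..., a_e> with a_1 < ... < a_e the minimal generators of S. *)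
Definition minimal_generators (S : set nat) (a : seq nat) : Prop :=
  sorted ltn a /\ minimal_generating_set S [set` a].

(* Main.v *)
Require Import Defs.
From mathcomp Require Import all_boot finmap.
From mathcomp Require Import boolp classical_sets functions cardinality.
From mathcomp Require Import zify.

Local Open Scope classical_set_scope.

(** The minimal generators of [S] are its irreducible elements: the positive
    ones that are not a sum of two positive elements of [S]
    ([minimal_generatorP]). If [x] is irreducible and [0 < n < x], then [n] or
    [x - n] is a gap, so the gaps together with their mirror images under
    [n |-> x - n] cover the [x - 1] integers between [0] and [x]. There are [g]
    gaps, whence [x <= 2 * g + 1] ([irreducible_le]).

    Thus [a_e = 2 * g + 1] says exactly that [2 * g + 1] is irreducible, i.e.
    that it lies in [S] and that [n |-> 2 * g + 1 - n] sends elements of [S]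
    between [1] and [2 * g] to gaps. In that situation the [2 * g] integers are
    covered by [g] gaps and their [g] mirror images, so there is no room for
    waste: no gap can be left out of such a cover ([mirror_cover_all]). Leaving
    out a gap whose mirror image is also a gap is therefore impossible, which is
    surjectivity of the map; leaving out the gaps beyond [2 * g] removes
    nothing, which, starting from the bijection, puts [2 * g + 1] in [S]. *)

Definition irreducible (S : set nat) (x : nat) : Prop :=
  [/\ S x, 0 < x & forall s t, S s -> S t -> 0 < s -> 0 < t -> s + t <> x].

Lemma generated_submonoid (A : set nat) : submonoid (generated A).
Proof.
split=> [M [[M0 _] _] //|x y Ax Ay M MA].
by case: (MA) => -[_ MD] _; apply: MD; [exact: Ax|exact: Ay].
Qed.

Lemma generated_min (A M : set nat) :
  submonoid M -> A `<=` M -> generated A `<=` M.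
Proof. by move=> sM AM x; apply. Qed.

Lemma sub_generated (A : set nat) : A `<=` generated A.
Proof. by move=> x Ax M [_]; apply. Qed.

(** A positive combination of generators that involves [x] is at least [x]. *)
Lemma generated_setD1 (A : set nat) (x y : nat) :
  generated A y -> y < x -> generated (A `\ x) y.
Proof.
have [B0 BD] := generated_submonoid (A `\ x).
have sT : submonoid [set z | generated (A `\ x) z \/ x <= z].
  split=> [|u v /= [Bu|xu] [Bv|xv]]; first by left.
  - by left; exact: BD.
  - by right; lia.
  - by right; lia.
  - by right; lia.
have AT : A `<=` [set z | generated (A `\ x) z \/ x <= z].
  move=> z Az /=; have [->|/eqP zx] := eqVneq z x; first by right.
  by left; apply: sub_generated.
by move=> /(generated_min _ _ sT AT) /= [//|]; lia.
Qed.

(** A reducible generator is redundant by [generated_setD1]; conversely removing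
    an irreducible element from [S] leaves a submonoid, so that no generating
    set can avoid it. *)
Lemma minimal_generatorP (S A : set nat) (x : nat) :
  minimal_generating_set S A -> A x <-> irreducible S x.
Proof.
move=> [<- minA]; have [S0 SD] := generated_submonoid A; split=> [Ax|].
  have needed : ~ generated (A `\ x) x.
    move=> Bx; suff BA : A `\ x = A by move: Ax; rewrite -BA => -[_]; apply.
    apply: minA; first exact: subDsetl.
    rewrite eqEsubset; split; apply: generated_min.
    + exact: generated_submonoid.
    + by move=> z [Az _]; exact: sub_generated.
    + exact: generated_submonoid.
    + move=> z Az; have [->//|/eqP zx] := eqVneq z x.
      exact: sub_generated.
  have [B0 BD] := generated_submonoid (A `\ x).
  split; first exact: sub_generated.
    by case: x {Ax BD} needed B0.
  move=> s t Ss St s0 t0 stx; apply: needed.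
  rewrite -[X in generated _ X]stx.
  by apply: BD; apply: generated_setD1 => //; lia.
move=> [Sx x0 irr]; apply: contrapT => nAx.
have sM : submonoid (generated A `\ x).
  split=> [|s t [Ss sx] [St tx]]; first by split=> //= x0'; lia.
  split; first exact: SD.
  case: s Ss sx => [//|s] Ss sx; case: t St tx => [|t] St tx.
    by rewrite addn0.
  exact: irr.
have AM : A `<=` generated A `\ x.
  by move=> z Az; split; [exact: sub_generated|move=> /= zx; rewrite zx in Az].
by case: (generated_min _ _ sM AM x Sx) => _; apply.
Qed.

(** Each entry of [s] accounts for at most two integers: itself and its mirror
    image. *)
Lemma mirror_cover_size (s : seq nat) (m : nat) :
  (forall n, 0 < n <= m -> (n \in s) || (m.+1 - n \in s)) -> m <= 2 * size s.
Proof.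
move=> cover; rewrite mul2n -addnn.
rewrite -{2}(size_map (fun n => m.+1 - n) s) -size_cat.
rewrite -[X in X <= _](size_iota 1 m); apply: uniq_leq_size (iota_uniq _ _) _.
move=> n; rewrite mem_iota mem_cat => n_in; have nm : 0 < n <= m by lia.
have /orP[->//|ns] := cover n nm.
by apply/orP; right; apply/mapP; exists (m.+1 - n) => //; lia.
Qed.

(** The bound of [mirror_cover_size] is attained here by [s], so a proper part of
    [s] is too small to cover. Applied to the gaps, with [p] describing those
    that are kept. *)
Lemma mirror_cover_all (s : seq nat) (p : pred nat) (m : nat) :
  m = 2 * size s ->
  (forall n, 0 < n <= m ->
     (n \in filter p s) || (m.+1 - n \in filter p s)) ->
  all p s.
Proof.
move=> -> /mirror_cover_size; rewrite size_filter leq_mul2l /= => ps.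
by rewrite all_count eqn_leq count_size.
Qed.

Lemma mem_gaps (S : set nat) (n : nat) : numerical_semigroup S ->
  n \in fset_set (gaps S) <-> 0 < n /\ ~ S n.
Proof.
move=> [_ finS]; rewrite in_fset_set; first by rewrite in_setE.
by apply: sub_finite_set finS => k [].
Qed.

Lemma irreducible_gap (S : set nat) (x n : nat) : numerical_semigroup S ->
  irreducible S x -> 0 < n < x ->
  (n \in fset_set (gaps S)) || (x - n \in fset_set (gaps S)).
Proof.
move=> hS [_ _ irr] nx; apply: contrapT => /negP; rewrite negb_or.
have inS k : 0 < k -> k \notin fset_set (gaps S) -> S k.
  move=> k0 /negP kG; apply: contrapT => nSk.
  by apply: kG; apply/(mem_gaps _ _ hS).
case/andP=> /inS Sn /inS Sxn.
by apply: (irr n (x - n)); [apply: Sn|apply: Sxn|..]; lia.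
Qed.

Lemma irreducible_le (S : set nat) (x : nat) : numerical_semigroup S ->
  irreducible S x -> x <= 2 * genus S + 1.
Proof.
move=> hS irr; have [_ x0 _] := irr.
have: x.-1 <= 2 * genus S; last by lia.
apply: mirror_cover_size => n nx; rewrite prednK //.
by apply: irreducible_gap => //; lia.
Qed.

(** The map lands in the gaps because [2 * g + 1] is no sum. If some gap [n] had
    a gap as mirror image, the gaps other than [n] would still cover. *)
Lemma irreducible_mirror_bij (S : set nat) : numerical_semigroup S ->
  irreducible S (2 * genus S + 1) ->
  set_bij ([set n | 1 <= n <= 2 * genus S] `&` S)
          ([set n | 1 <= n <= 2 * genus S] `\` S)
          (fun n => 2 * genus S + 1 - n).
Proof.
move=> hS irr; set g := genus S in irr *; have [_ _ noSum] := irr; split.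
- move=> n [/= ng Sn]; split=> /=; first by lia.
  by move=> Sn'; apply: (noSum _ _ Sn Sn'); lia.
- by move=> m n; rewrite !in_setE /= => -[/= mg _] [/= ng _]; lia.
- move=> n [/= ng nSn]; exists (2 * g + 1 - n) => /=; last by lia.
  split=> /=; first by lia.
  apply: contrapT => nSn'.
  have nG : n \in fset_set (gaps S) by apply/(mem_gaps _ _ hS); split=> //; lia.
  have nG' : 2 * g + 1 - n \in fset_set (gaps S).
    by apply/(mem_gaps _ _ hS); split=> //; lia.
  have /allP/(_ n nG) : all (predC1 n) (fset_set (gaps S)).
    2: by rewrite /= eqxx.
  apply: (mirror_cover_all _ _ (2 * g)) => // k kg.
  rewrite !mem_filter /= -[(2 * g).+1]addn1.
  (* [n] and its mirror image differ because their sum is odd *)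
  have [->|kn] := eqVneq k n; first by rewrite nG' andbT /=; lia.
  have [kn'|_] := eqVneq (2 * g + 1 - k) n.
    by rewrite /= orbF (_ : k = 2 * g + 1 - n) //; lia.
  by apply: irreducible_gap => //; lia.
Qed.

(** That elements of [S] are mapped to gaps is enough: the gaps up to [2 * g]
    then form a cover, so they are all the gaps and [2 * g + 1] is in [S]. *)
Lemma mirror_bij_irreducible (S : set nat) : numerical_semigroup S ->
  set_bij ([set n | 1 <= n <= 2 * genus S] `&` S)
          ([set n | 1 <= n <= 2 * genus S] `\` S)
          (fun n => 2 * genus S + 1 - n) ->
  irreducible S (2 * genus S + 1).
Proof.
move=> hS; set g := genus S => -[mirror _ _].
have mirror_gap n : 0 < n <= 2 * g -> S n -> ~ S (2 * g + 1 - n).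
  by move=> ng Sn; have [] := mirror n (conj ng Sn).
have /allP gap_le : all (fun n => n <= 2 * g) (fset_set (gaps S)).
  apply: (mirror_cover_all _ _ (2 * g)) => // n ng.
  rewrite !mem_filter -[(2 * g).+1]addn1.
  have [Sn|nSn] := pselect (S n); apply/orP; [right|left]; apply/andP.
    split; first by lia.
    by apply/(mem_gaps _ _ hS); split; [lia|exact: mirror_gap].
  by split; [lia|apply/(mem_gaps _ _ hS); split=> //; lia].
split; last 1 first.
- move=> s t Ss St s0 t0 st; apply: (mirror_gap s _ Ss); first by lia.
  by rewrite (_ : 2 * g + 1 - s = t) //; lia.
- apply: contrapT => nS; have /gap_le : 2 * g + 1 \in fset_set (gaps S).
    by apply/(mem_gaps _ _ hS); split=> //; lia.
  by lia.
- by lia.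
Qed.

Lemma sorted_ltn_le_last (a : seq nat) (x : nat) :
  sorted ltn a -> x \in a -> x <= last 0 a.
Proof.
case: a => // b a /=; elim: a b x => [|c a IH] b x /=.
  by rewrite inE => _ /eqP->.
move=> /andP[bc ca]; rewrite inE => /orP[/eqP->|]; last exact: IH.
by apply: leq_trans (ltnW bc) _; apply: IH ca _; rewrite mem_head.
Qed.

(* [last 0 a] is a_e: a numerical semigroup is not {0}, so a is nonempty. *)
Theorem proposition2p2 (S : set nat) (a : seq nat) (g : nat)
    (hS : numerical_semigroup S) (ha : minimal_generators S a)
    (hg : g = genus S) :
  last 0 a = 2 * g + 1 <->
  set_bij ([set n | 1 <= n <= 2 * g] `&` S)
          ([set n | 1 <= n <= 2 * g] `\` S)
          (fun n => 2 * g + 1 - n).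
Proof.
have [a_sorted a_min] := ha; rewrite hg.
have lastP : 0 < last 0 a -> last 0 a \in a.
  by case: (a) => //= b s _; exact: mem_last.
split=> [a_e|/(mirror_bij_irreducible _ hS) irr].
  apply: irreducible_mirror_bij => //; rewrite -a_e.
  by apply/(minimal_generatorP _ _ _ a_min) => /=; apply: lastP; lia.
have /= le_last := sorted_ltn_le_last _ _ a_sorted
  (proj2 (minimal_generatorP _ _ _ a_min) irr).
have /lastP last_a : 0 < last 0 a by lia.
have := irreducible_le _ _ hS (proj1 (minimal_generatorP _ _ _ a_min) last_a).
by lia.
Qed.
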